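(* Let $P=\{p\in\mathbb{R}^{n_p}:\pi_k(p)\ge 0,\ k=1,\dots,K_1\}$ with $\pi_k\in\mathbb{R}[p]$, and let $H(p)=(Q,E,D(p),F(p),G(p),R(p))$, $p\in P$, be a family of cyclic hybrid systems with polynomial data $g_{qk}$ ($1\le k\le K_q$), $f_q$, $h_{e,0}$, $h_{e,l}$ ($1\le l\le N_q$, $q=s(e)$), $\phi_e$ depending polynomially on $(x,p)$. Let $z=\{z_q\}_{q\in Q}$ be a common Zeno equilibrium, i.e. a Zeno equilibrium of $H(p)$ for every $p\in P$. For each $q\in Q$ let $w_{qk}\in\mathbb{R}[x]$, $k=1,\dots,K_{qw}$, be such that $W_q:=\{x\in\mathbb{R}^n: w_{qk}(x)>0,\ k=1,\dots,K_{qw}\}$ is a neighborhood of $z_q$. Suppose there exist (i) $a_{qk},c_{qk},i_{qk}\in\Sigma_{x,p}$ for $k=1,\dots,K_{qw}$, $q\in Q$; (ii) $b_{qk},d_{qk},j_{qk}\in\Sigma_{x,p}$ for $k=1,\dots,K_q$, $q\in Q$; (iii) $\eta_{qk},\beta_{qk},\zeta_{qk}\in\Sigma_{x,p}$ for $k=1,\dots,K_1$, $q\in Q$; (iv) $m_{e,l}\in\Sigma_{x,p}$ for $e\in E$, $l=1,\dots,N_q$ (with $q=s(e)$); (v) $V_q\in\mathbb{R}[x,p]$ for $q\in Q$ and $m_{e,0}\in\mathbb{R}[x,p]$ for $e\in E$; (vi) constants $\alpha,\gamma>0$ and $r_q\in(0,1]$ for $q\in Q$, with $r_q<1$ for some $q\in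 Q$; such that $$V_q-\alpha x^Tx-\sum_{k=1}^{K_{qw}}a_{qk}w_{qk}-\sum_{k=1}^{K_q}b_{qk}g_{qk}-\sum_{k=1}^{K_1}\eta_{qk}\pi_k\in\Sigma_{x,p}\quad\text{for all }q\in Q,$$ $$V_q(z_q,p)=0\quad\text{for all }q\in Q,\ p\in P,$$ $$-(\nabla_xV_q)^Tf_q-\gamma-\sum_{k=1}^{K_{qw}}c_{qk}w_{qk}-\sum_{k=1}^{K_q}d_{qk}g_{qk}-\sum_{k=1}^{K_1}\beta_{qk}\pi_k\in\Sigma_{x,p}\quad\text{for all }q\in Q,$$ $$r_qV_q-V_{q'}(\phi_e)-m_{e,0}h_{e,0}-\sum_{l=1}^{N_q}m_{e,l}h_{e,l}-\sum_{k=1}^{K_{qw}}i_{qk}w_{qk}-\sum_{k=1}^{K_q}j_{qk}g_{qk}-\sum_{k=1}^{K_1}\zeta_{qk}\pi_k\in\Sigma_{x,p}\quad\text{for all }e=(q,q')\in E.$$ Then, for any $p\in P$, $z$ is a Zeno stable Zeno equilibrium of $H(p)$.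
   Context: $\mathbb{R}[x,p]$ is the ring of real polynomials in $x=(x_1,\dots,x_n)$ and $p=(p_1,\dots,p_{n_p})$; $\Sigma_{x,p}\subset\mathbb{R}[x,p]$ is the set of finite sums of squares of polynomials in $\mathbb{R}[x,p]$. $V_{q'}(\phi_e)$ denotes $(x,p)\mapsto V_{q'}(\phi_e(x,p),p)$. Hybrid system: a tuple $H=(Q,E,D,F,G,R)$ where $Q$ is a finite set of discrete modes; $E\subset Q\times Q$ is a set of edges; $D=\{D_q\}_{q\in Q}$ with domains $D_q\subseteq\mathbb{R}^n$; $F=\{f_q\}_{q\in Q}$ with vector fields $f_q:D_q\to\mathbb{R}^n$; $G=\{G_e\}_{e\in E}$ with guard sets $G_e\subset D_q$ for $e=(q,q')$; $R=\{\phi_e\}_{e\in E}$ with reset maps $\phi_e:G_e\to D_{q'}$ for $e=(q,q')$. For $e=(q,q')$ write $s(e)=q$, $t(e)=q'$. Parameterized family: $H(p)$ has the same $Q,E$ for all $p$; $D_q(p)=\{x\in\mathbb{R}^n: g_{qk}(x,p)\ge 0,\ k=1,\dots,K_q\}$ with $g_{qk}\in\mathbb{R}[x,p]$; for $e$ with $s(e)=q$, $G_e(p)=\{x\in D_q(p): h_{e,0}(x,p)=0,\ h_{e,k}(x,p)\ge 0,\ k=1,\dots,N_q\}$ with $h_{e,k}\in\mathbb{R}[x,p]$; the reset maps $\phi_e(x,p)=[\phi_{e,1}(x,p),\dots,\phi_{e,n}(x,p)]^T$ have $\phi_{e,j}\in\mathbb{R}[x,p]$; the vector fields $f_q(x,p)$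 are vectors of polynomials in $\mathbb{R}[x,p]$. Cyclic: for each $q\in Q$ there are a unique edge $e_q\in E$ with $s(e_q)=q$ and a unique edge $e_q'\in E$ with $t(e_q')=q$, and the modes and edges form a connected digraph. Execution of a hybrid system with initial condition $(q_0,x_0)$: a tuple $\chi=(I,T,\rho,C)$ where $I\subseteq\mathbb{N}$ indexes intervals (starting at $1$); $T=\{T_i\}_{i\in I}$ are consecutive open time intervals $T_i=(\tau_i,\tau_{i+1})\subset\mathbb{R}_+$; $\rho:I\to Q$; $C=\{c_i\}_{i\in I}$ are continuously differentiable functions on $T_i$ (values at endpoints being understood as limits), such that: $c_1(0)=x_0$, $\rho(1)=q_0$ (with $\tau_1=0$); $\dot c_i(t)=f_{\rho(i)}(c_i(t))$ and $c_i(t)\in D_{\rho(i)}$ for $t\in T_i$, $i\in I$; $c_i(\tau_{i+1})\in G_{(\rho(i),\rho(i+1))}$; and $c_{i+1}(\tau_{i+1})=\phi_{(\rho(i),\rho(i+1))}(c_i(\tau_{i+1}))$ (the last two whenever the transition from interval $i$ to $i+1$ occurs). The execution is Zeno if $I=\mathbb{N}$ and $\lim_{i\to\infty}\tau_i<\infty$. Zeno equilibrium: a set $z=\{z_q\}_{q\in Q}$ with $z_q\in D_q$ such that for each $e=(q,q')\in E$, $z_q\in G_e$ and $\phi_e(z_q)=z_{q'}$, and $f_q(z_q)\ne 0$ for all $q\in Q$. Zeno stability: a Zeno equilibrium $z$ is Zeno stable if for each $q\in Q$ there is a neighborhood $Z_q$ of $z_q$ (in $D_q$) such that for any initial condition $(q_0,x_0)$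 with $x_0\in Z_{q_0}$, the execution $\chi=(I,T,\rho,C)$ with that initial condition is Zeno, and for any $\epsilon>0$ there is $N\in\mathbb{N}$ such that $i>N$ implies $\|c_i(\tau_{i+1})-z_{\rho(i)}\|\le\epsilon$.
   Formalization: In Zeno stability, ''the execution'' is read as every complete execution (infinitely many intervals, or an unbounded last one); existence of one is not claimed, since executions may block at the boundary of a domain off the guard, where the original claim fails. *)

(* Defs.v *)
(* MathComp-Analysis over an arbitrary [R : realType], with multinomials for
   polynomials.  The notations of [mpoly] clash with those of the analysis
   library, hence the filtered import. *)
From mathcomp Require Import all_boot all_order all_algebra.
From mathcomp Require Export -(notations) mpoly.
From mathcomp Require Import all_classical all_reals all_analysis.

Set Implicit Arguments.
Unset Strict Implicit.
Unset Printing Implicit Defensive.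

Import Order.TTheory GRing.Theory Num.Theory.
Import numFieldNormedType.Exports.

Local Open Scope classical_set_scope.
Local Open Scope ring_scope.

Section HybridSystems.
Variables (R : realType) (n : nat).

(* The vector fields and the reset maps are total functions on R^n: the values
   of [vfield H q] outside [dom H q], those of [reset H e] outside [guard H e],
   and everything attached to a pair [e] outside [edges H] are irrelevant. *)
Record hybrid_data := HybridData {
  mode : finType;
  edges : {set mode * mode};
  dom : mode -> set 'rV[R]_n;
  vfield : mode -> 'rV[R]_n -> 'rV[R]_n;
  guard : mode * mode -> set 'rV[R]_n;
  reset : mode * mode -> 'rV[R]_n -> 'rV[R]_n }.

Arguments dom : clear implicits.
Arguments vfield : clear implicits.
Arguments guard : clear implicits.
Arguments reset : clear implicits.

Definition is_hybrid_system (H : hybrid_data) : Prop :=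
  forall e, e \in edges H ->
    guard H e `<=` dom H e.1 /\
    (forall x, guard H e x -> dom H e.2 (reset H e x)).

Definition adjacent (H : hybrid_data) : rel (mode H) :=
  [rel q q' | ((q, q') \in edges H) || ((q', q) \in edges H)].

Definition cyclic_system (H : hybrid_data) : Prop :=
  [/\ forall q, exists! e, e \in edges H /\ e.1 = q,
      forall q, exists! e, e \in edges H /\ e.2 = q
    & forall q q', connect (@adjacent H) q q'].

(* [time i] and [time i.+1] are the endpoints of the i-th interval; the right
   endpoint of the last interval, if there is one, may be +oo.  Only the values
   at indices in [index], and [time i.+1] for [i] in [index], are relevant. *)
Record trajectory (Q : Type) := Trajectory {
  index : set nat;
  time : nat -> \bar R;
  mode_at : nat -> Q;
  curve : nat -> R -> 'rV[R]_n }.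

(* Intervals may be degenerate (instantaneous transitions): the trajectory that
   stays at a Zeno equilibrium consists of these.  Limits of the i-th curve at
   the endpoints of its interval are its values there, by continuity on the
   closed interval. *)
Definition is_execution (H : hybrid_data) (q0 : mode H) (x0 : 'rV[R]_n)
    (chi : trajectory (mode H)) : Prop :=
  let: Trajectory J tau rho c := chi in
  [/\ [/\ J 1%N, (forall i, J i -> (1 <= i)%N)
        & forall i, (1 <= i)%N -> J i.+1 -> J i],
      [/\ tau 1%N = 0%:E, (forall i, J i -> tau i \is a fin_num)
        & forall i, J i -> (tau i <= tau i.+1)%E],
      rho 1%N = q0 /\ c 1%N 0 = x0,
      (forall i, J i ->
        {within [set t : R | (tau i <= t%:E <= tau i.+1)%E], continuous (c i)} /\
        forall t : R, (tau i < t%:E < tau i.+1)%E ->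
          [/\ is_derive t 1 (c i) (vfield H (rho i) (c i t)),
              {for t, continuous (derive1 (c i))}
            & dom H (rho i) (c i t)])
    & forall i, J i -> J i.+1 ->
        let e := (rho i, rho i.+1) in
        let y := c i (fine (tau i.+1)) in
        [/\ e \in edges H, guard H e y
          & c i.+1 (fine (tau i.+1)) = reset H e y]].

Definition all_indices : set nat := [set i | (1 <= i)%N].

(* Either infinitely many intervals, or a last one that is unbounded: such an
   execution has no proper extension and is not blocked in finite time. *)
Definition complete (Q : Type) (chi : trajectory Q) : Prop :=
  index chi = all_indices \/
  exists2 i, index chi i & time chi i.+1 = +oo%E.

Definition is_zeno (Q : Type) (chi : trajectory Q) : Prop :=
  index chi = all_indices /\
  exists tinf : R, time chi i @[i --> \oo] --> tinf%:E.

Definition zeno_equilibrium (H : hybrid_data) (z : mode H -> 'rV[R]_n) : Prop :=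
  [/\ forall q, dom H q (z q),
      forall e, e \in edges H -> guard H e (z e.1) /\ reset H e (z e.1) = z e.2
    & forall q, vfield H q (z q) != 0].

Definition euclidean_norm (x : 'rV[R]_n) : R :=
  Num.sqrt (\sum_(j < n) x 0 j ^+ 2).

(* The guards need not force a transition, and a system may block, so that an
   initial condition may have several complete executions or none; "the
   execution" starting there stands for each of the complete ones. *)
Definition zeno_stable (H : hybrid_data) (z : mode H -> 'rV[R]_n) : Prop :=
  exists Z : mode H -> set 'rV[R]_n,
    (forall q, Z q `<=` dom H q /\ within (dom H q) (nbhs (z q)) (Z q)) /\
    forall q0 x0, Z q0 x0 ->
      forall chi : trajectory (mode H),
        is_execution q0 x0 chi -> complete chi ->
        is_zeno chi /\
        forall eps : R, 0 < eps -> exists N : nat, forall i, (N < i)%N ->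
          euclidean_norm (curve chi i (fine (time chi i.+1))
                          - z (mode_at chi i)) <= eps.

End HybridSystems.

Arguments dom {R n} h _ _.
Arguments vfield {R n} h _ _.
Arguments guard {R n} h _ _.
Arguments reset {R n} h _ _.

Section PolynomialFamilies.
Variables (R : realType) (n np : nat).

(* In R[x, p], the first n variables are x and the last np ones are p. *)
Definition varx (j : 'I_n) : mpoly (n + np) R := mpolyX R (mnm1 (lshift np j)).
Definition varp (k : 'I_np) : mpoly (n + np) R := mpolyX R (mnm1 (rshift n k)).

Definition evalxp (u : mpoly (n + np) R) (x : 'rV[R]_n) (p : 'rV[R]_np) : R :=
  meval (fun i => row_mx x p 0 i) u.

Definition of_polyx (w : mpoly n R) : mpoly (n + np) R :=
  comp_mpoly [tuple varx j | j < n] w.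
Definition of_polyp (w : mpoly np R) : mpoly (n + np) R :=
  comp_mpoly [tuple varp k | k < np] w.

(* V(phi(x, p), p) *)
Definition compx (V : mpoly (n + np) R) (phi : 'I_n -> mpoly (n + np) R) :
    mpoly (n + np) R :=
  comp_mpoly [tuple match fintype.split i with inl j => phi j | inr k => varp k end
             | i < n + np] V.

Definition sos (u : mpoly (n + np) R) : Prop :=
  exists s : seq (mpoly (n + np) R), u = \sum_(v <- s) v ^+ 2.

Definition sqnormx : mpoly (n + np) R := \sum_(j < n) varx j ^+ 2.

Definition lie_derivx (V : mpoly (n + np) R) (f : 'I_n -> mpoly (n + np) R) :
    mpoly (n + np) R :=
  \sum_(j < n) mderiv (lshift np j) V * f j.

Definition semialgebraic (K : nat) (pi_ : 'I_K -> mpoly np R) :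
    set 'rV[R]_np :=
  [set p | forall k, 0 <= meval (fun i => p 0 i) (pi_ k)].

Definition semialgebraic_gt (K : nat) (w : 'I_K -> mpoly n R) : set 'rV[R]_n :=
  [set x | forall k, 0 < meval (fun i => x 0 i) (w k)].

(* Data attached to a pair e is relevant only for e in [fedges]. *)
Record poly_family (Q : finType) := PolyFamily {
  fedges : {set Q * Q};
  Kdom : Q -> nat;
  gdom : forall q, 'I_(Kdom q) -> mpoly (n + np) R;
  fpoly : Q -> 'I_n -> mpoly (n + np) R;
  Nguard : Q -> nat;
  hguard0 : Q * Q -> mpoly (n + np) R;
  hguard : forall e : Q * Q, 'I_(Nguard e.1) -> mpoly (n + np) R;
  phipoly : Q * Q -> 'I_n -> mpoly (n + np) R }.

Arguments Kdom [Q] p _.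
Arguments gdom [Q] p _ _.
Arguments Nguard [Q] p _.
Arguments hguard [Q] p _ _.

Definition system_at (Q : finType) (F : poly_family Q) (p : 'rV[R]_np) :
    hybrid_data R n :=
  let D q := [set x | forall k, 0 <= evalxp (gdom F q k) x p] in
  {| mode := Q;
     edges := fedges F;
     dom := D;
     vfield := fun q x => \row_j evalxp (fpoly F q j) x p;
     guard := fun e => [set x | [/\ D e.1 x, evalxp (hguard0 F e) x p = 0
                & forall l, 0 <= evalxp (hguard F e l) x p]];
     reset := fun e x => \row_j evalxp (phipoly F e j) x p |}.

End PolynomialFamilies.

Arguments gdom {R n np Q} p q _.
Arguments hguard {R n np Q} p e _.

(* Main.v *)
(* On the part of the domain D_q where all w_q are positive, the certificates
   say that V_q >= alpha |x|^2, that V_q decreases at rate at least gamma along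
   the flow, and that a transition q -> q' gives V_q' <= r_q V_q.  Since
   V_q(z_q) = 0, the first of these forces z_q = 0.  A small sublevel set of V
   is therefore a trap: an execution starting there stays close to 0, the time
   it can spend is at most V / gamma, so that it is Zeno, and V is multiplied by
   some r_q < 1 in each turn around the cycle, so that it tends to 0, and the
   execution with it. *)
Require Import Defs.
From mathcomp Require Import all_boot all_order all_algebra.
From mathcomp Require Import all_classical all_reals all_analysis.
From mathcomp Require Import ring lra.
Import Order.TTheory GRing.Theory Num.Theory.
Import numFieldNormedType.Exports.
Local Open Scope classical_set_scope.
Local Open Scope ring_scope.

(** * First hitting times, and decay of a Lyapunov function along a curve *)

(** The times in [[a, b]] where [g] is at least [k] form a nonempty compact set; [s] is its minimum.
    The intermediate value theorem on [[a, s]] yields a point with value exactly [k], which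
    minimality identifies with [s]. *)
Lemma first_hit {R : realType} (g : R -> R) (a b k : R) :
  a <= b -> {within `[a, b], continuous g} -> g a < k -> k <= g b ->
  exists s, [/\ a <= s <= b, g s = k & forall t, a <= t < s -> g t < k].
Proof.
move=> ab cg ka kb.
pose S := [set t | k <= g t] `&` `[a, b]%classic.
have cS : compact S.
  (* As [g] is continuous only within [[a, b]], the superlevel set is closed only relatively: its
     trace on the segment is that of some closed [U]. *)
  have clS : closed ([set t | k <= g t] : set (subspace `[a, b])).
    exact: (closed_comp (fun x _ => cg x) (@closed_ge _ k)).
  move/closed_subspaceP : clS => [U cU US].
  apply: (subclosed_compact _ (@segment_compact R a b)); last by move=> x [].
  rewrite /S -US; apply: closedI => //; exact: interval_closed.
have [||s sS smin] := @compact_EVT_min _ R id S _ cS.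
  by exists b; split => //=; rewrite in_itv /= ab lexx.
  by apply: continuous_subspaceT => x; exact: cvg_id.
move: sS; rewrite inE => -[/= ks]; rewrite in_itv /= => /andP[as_ sb].
have lt_s t : a <= t < s -> g t < k.
  move=> /andP[at_ ts]; rewrite ltNge; apply/negP => kt.
  have : s <= t.
    apply: smin; rewrite inE; split => //=.
    by rewrite in_itv /= at_ (le_trans (ltW ts)).
  by rewrite leNgt ts.
exists s; split => //; first by rewrite as_.
have [||u /[!in_itv]/= /andP[au us] gu] := @IVT _ g a s k as_.
- apply: continuous_subspaceW cg => x /=; rewrite !in_itv /= => /andP[-> xs].
  exact: le_trans xs sb.
- by rewrite ge_min le_max (ltW ka) ks orbT.
move: us; rewrite le_eqVlt => /predU1P[<- //|us].
by move: (lt_s u); rewrite au us gu ltxx => /(_ isT).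
Qed.

(** A bootstrap: the bound on [dv] is available only while [N <= k], and [N] stays below [k] only
    because [v] decays. The mean value theorem gives the decay up to any time before which [N <= k];
    a first hitting time then excludes escape. *)
Lemma lyapunov_decay {R : realType} (N v dv : R -> R)
    (a b k alpha gamma : R) :
  0 < alpha -> 0 <= gamma -> a <= b ->
  {within `[a, b], continuous N} -> {within `[a, b], continuous v} ->
  (forall t, a < t < b -> is_derive t 1 v (dv t)) ->
  (forall t, a <= t <= b -> N t <= k -> alpha * N t <= v t) ->
  (forall t, a < t < b -> N t <= k -> dv t <= - gamma) ->
  N a < k -> v a < alpha * k ->
  forall t, a <= t <= b -> N t < k /\ v t <= v a - gamma * (t - a).
Proof.
move=> al0 ga0 ab cN cv dvP Nv dvle Na va.
have decay s : a <= s <= b -> (forall t, a <= t < s -> N t <= k) ->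
    v s <= v a - gamma * (s - a).
  move=> /andP[as_ sb] Nk.
  move: as_; rewrite le_eqVlt => /predU1P[<-|as_].
    by rewrite subrr mulr0 subr0.
  have [||u /[!in_itv]/= /andP[au us] E] := @MVT _ v dv a s as_.
  - move=> x /[!in_itv]/= /andP[ax xs]; apply: dvP.
    by rewrite ax (lt_le_trans xs).
  - apply: continuous_subspaceW cv => x /=; rewrite !in_itv /= => /andP[-> xs].
    exact: le_trans xs sb.
  have : dv u * (s - a) <= - gamma * (s - a).
    apply: ler_wpM2r; first by rewrite subr_ge0 ltW.
    apply: dvle; last by apply: Nk; rewrite ltW.
    by rewrite au (lt_le_trans us).
  by rewrite -E mulNr; lra.
(* At the first time where [N] reaches [k], the bound [alpha * N <= v] would
   give [alpha * k <= v <= v a]. *)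
suff Nk t : a <= t <= b -> N t < k.
  move=> t tab; split; first exact: Nk.
  apply: decay => // s /andP[as_ st]; apply/ltW/Nk.
  by move/andP : tab => [_ tb]; rewrite as_ (le_trans (ltW st)).
move=> /andP[at_ tb]; rewrite ltNge; apply/negP => kN.
have [||s [/andP[as_ st] ks Ns]] := @first_hit _ N a t k at_ _ _ kN.
  apply: continuous_subspaceW cN => x /=; rewrite !in_itv /= => /andP[-> xs].
  exact: le_trans xs tb.
  exact: Na.
have sb : s <= b by exact: le_trans st tb.
have vs : v s <= v a - gamma * (s - a).
  by apply: decay => [|u us]; [rewrite as_|apply/ltW/Ns].
have : alpha * k <= v s.
  by rewrite -ks Nv ?as_ ?sb ?ks ?lexx.
have : 0 <= gamma * (s - a) by rewrite mulr_ge0 // subr_ge0.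
by lra.
Qed.

(** * Evaluation of polynomials in [(x, p)]: signs, continuity, chain rule *)

(** Constants and variables generate the polynomial ring, so continuity and the chain rule reduce to
    these generators and to the sum and product rules. *)
Lemma mpoly_ring_ind n (R : comNzRingType) (P : mpoly n R -> Prop) :
  (forall a, P (mpolyC n a)) -> (forall i, P (mpolyX R (mnm1 i))) ->
  (forall u v, P u -> P v -> P (u + v)) ->
  (forall u v, P u -> P v -> P (u * v)) -> forall u, P u.
Proof.
move=> PC PX PD PM u.
have P1 : P 1 by rewrite -mpolyC1; exact: PC.
elim/mpolyind: u => [|a m u _ _ Pu]; first by rewrite -mpolyC0; exact: PC.
apply: (PD) => //; rewrite -mul_mpolyC; apply: (PM) => //.
rewrite mpolyXE_id; elim/big_ind: _ => // i _.
by elim: (m i) => [|k Pk]; rewrite ?expr0// exprS; exact: PM.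
Qed.

Section EvalXP.
Context {R : realType} {n np : nat}.
Implicit Types (u v : mpoly (n + np) R) (x : 'rV[R]_n) (p : 'rV[R]_np).

Lemma sos_ge0 u x p : sos u -> 0 <= evalxp u x p.
Proof.
move=> [s ->]; rewrite /evalxp raddf_sum sumr_ge0//= => v _.
by rewrite expr2 mevalM -expr2 sqr_ge0.
Qed.

Lemma evalxp_sos_comb_ge0 (k : nat) (s g : 'I_k -> mpoly (n + np) R) x p :
  (forall l, sos (s l)) -> (forall l, 0 <= evalxp (g l) x p) ->
  0 <= evalxp (\sum_(l < k) s l * g l) x p.
Proof.
move=> s_sos g0; rewrite /evalxp raddf_sum sumr_ge0//= => l _.
by rewrite mevalM mulr_ge0 ?g0// -/(evalxp _ x p) sos_ge0.
Qed.

Lemma evalxp_varx j x p : evalxp (varx R np j) x p = x 0 j.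
Proof. by rewrite /evalxp mevalXU row_mxEl. Qed.

Lemma evalxp_varp k x p : evalxp (varp R n k) x p = p 0 k.
Proof. by rewrite /evalxp mevalXU row_mxEr. Qed.

Lemma evalxp_of_polyx (w : mpoly n R) x p :
  evalxp (of_polyx np w) x p = meval (fun i => x 0 i) w.
Proof.
rewrite /evalxp comp_mpoly_meval; apply: meval_eq => i.
by rewrite tnth_mktuple -/(evalxp _ x p) evalxp_varx.
Qed.

Lemma evalxp_of_polyp (w : mpoly np R) x p :
  evalxp (of_polyp n w) x p = meval (fun i => p 0 i) w.
Proof.
rewrite /evalxp comp_mpoly_meval; apply: meval_eq => i.
by rewrite tnth_mktuple -/(evalxp _ x p) evalxp_varp.
Qed.

Lemma evalxp_compx u (phi : 'I_n -> mpoly (n + np) R) x p :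
  evalxp (compx u phi) x p = evalxp u (\row_j evalxp (phi j) x p) p.
Proof.
rewrite /evalxp comp_mpoly_meval; apply: meval_eq => i.
rewrite tnth_mktuple; case: splitP => j ij.
  by rewrite [i](_ : i = lshift np j) ?row_mxEl ?mxE//; exact: val_inj.
rewrite -/(evalxp _ x p) evalxp_varp.
by rewrite [i](_ : i = rshift n j) ?row_mxEr//; exact: val_inj.
Qed.

Lemma evalxp_sqnormx x p :
  evalxp (sqnormx R n np) x p = \sum_(j < n) x 0 j ^+ 2.
Proof.
rewrite /evalxp /sqnormx raddf_sum; apply: eq_bigr => j _ /=.
by rewrite !expr2 mevalM -/(evalxp _ x p) evalxp_varx.
Qed.

Lemma evalxp_continuous u p : continuous (fun x => evalxp u x p).
Proof.
elim/mpoly_ring_ind: u => [a|i|u v cu cv|u v cu cv].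
- have -> : (fun x => evalxp (mpolyC (n + np) a) x p) = cst a.
    by apply/funext => x; rewrite /evalxp mevalC.
  by move=> x; exact: cst_continuous.
- case: (split_ordP i) => j ->.
    have -> : (fun x => evalxp (varx R np j) x p) = (fun x => x 0 j).
      by apply/funext => x; rewrite evalxp_varx.
    exact: coord_continuous.
  have -> : (fun x => evalxp (varp R n j) x p) = cst (p 0 j).
    by apply/funext => x; rewrite evalxp_varp.
  by move=> x; exact: cst_continuous.
- have -> : (fun x => evalxp (u + v) x p) =
      (fun x => evalxp u x p + evalxp v x p).
    by apply/funext => x; rewrite /evalxp mevalD.
  by move=> x; exact: cvgD (cu x) (cv x).
- have -> : (fun x => evalxp (u * v) x p) =
      (fun x => evalxp u x p * evalxp v x p).
    by apply/funext => x; rewrite /evalxp mevalM.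
  by move=> x; exact: cvgM (cu x) (cv x).
Qed.

(** The parameter [p] is frozen along the curve, so only the partial derivatives in the first [n]
    variables contribute. *)
Lemma is_derive_evalxp u p (c : R -> 'rV[R]_n) (t : R) (dc : 'rV[R]_n) :
  is_derive t 1 c dc ->
  is_derive t 1 (fun s => evalxp u (c s) p)
    (\sum_(j < n) evalxp (mderiv (lshift np j) u) (c t) p * dc 0 j).
Proof.
move=> dcP.
have dcj j : is_derive t 1 (fun s => c s 0 j) (dc 0 j).
  apply: DeriveDef; first exact: (derivable_mxP _ _ _).1.
  by rewrite -(@derive_val _ _ _ _ _ _ _ dcP) derive_mx// mxE.
elim/mpoly_ring_ind: u => [a|i|u v du dv|u v du dv].
- rewrite big1 => [|j _]; last by rewrite mderivC /evalxp meval0 mul0r.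
  rewrite /evalxp; under eq_fun do rewrite mevalC; exact: is_derive_cst.
- have E j : evalxp (mderiv (lshift np j) (mpolyX R (mnm1 i))) (c t) p
      = (i == lshift np j)%:R.
    rewrite mderivX mnm1E /evalxp mevalZ mevalX; case: eqVneq => [->|_].
      by rewrite big1 ?mulr1// => l _; rewrite mnmBE subnn expr0.
    by rewrite mul0r.
  under eq_bigr do rewrite E; case: (split_ordP i) => j {E}-> {i}.
    under eq_fun do rewrite evalxp_varx; apply: is_derive_eq (dcj j) _.
    rewrite (bigD1 j)//= eqxx mul1r big1 ?addr0// => l lj.
    by rewrite (inj_eq (@lshift_inj _ _)) eq_sym (negbTE lj) mul0r.
  rewrite big1 => [|l _]; last by rewrite eq_rlshift mul0r.
  under eq_fun do rewrite evalxp_varp; exact: is_derive_cst.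
- rewrite /evalxp; under eq_fun do rewrite mevalD.
  apply: is_derive_eq (is_deriveD du dv) _.
  by rewrite -big_split/=; apply: eq_bigr => j _; rewrite mderivD mevalD mulrDl.
- rewrite /evalxp; under eq_fun do rewrite mevalM.
  apply: is_derive_eq (is_deriveM du dv) _.
  rewrite !scaler_sumr -big_split/=; apply: eq_bigr => j _.
  by rewrite mderivM mevalD !mevalM /evalxp /GRing.scale/=; ring.
Qed.

End EvalXP.

(** * The squared Euclidean norm and neighborhoods of the origin *)

Section NormSq.
Context {R : realType} {n : nat}.

Definition normsq (x : 'rV[R]_n) : R := \sum_(j < n) x 0 j ^+ 2.

Lemma normsq_ge0 x : 0 <= normsq x.
Proof. by apply: sumr_ge0 => j _; exact: sqr_ge0. Qed.

Lemma normsq_le0 x : normsq x <= 0 -> x = 0.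
Proof.
move=> x0; apply/rowP => j; rewrite mxE; apply/eqP; rewrite -sqrf_eq0.
rewrite eq_le sqr_ge0 andbT (le_trans _ x0)// /normsq (bigD1 j)//= lerDl.
by apply: sumr_ge0 => i _; exact: sqr_ge0.
Qed.

Lemma nbhs0_normsq (U : set 'rV[R]_n) : nbhs (0 : 'rV[R]_n) U ->
  exists2 k, 0 < k & forall x, normsq x <= k -> U x.
Proof.
(* The ambient norm is the sup norm, and each [x 0 j ^+ 2] is at most [normsq x]. Halving [e] turns
   the large inequality on [normsq x] into membership in the open ball. *)
move=> /nbhs_ballP[e /= e0 eU]; exists ((e / 2) ^+ 2).
  by rewrite exprn_gt0// divr_gt0.
move=> x xe; apply: eU; rewrite -ball_normE/= sub0r normrN.
rewrite [ltLHS]/Num.Def.normr/= mx_normrE.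
apply: (@le_lt_trans _ _ (e / 2)); last by rewrite ltr_pdivrMr//; lra.
apply: bigmax_le => [|[i j] _ /=]; first by rewrite divr_ge0// ltW.
rewrite ord1 -(@ler_pXn2r _ 2)// ?nnegrE// ?divr_ge0 ?(ltW e0)//.
rewrite real_normK ?num_real// (le_trans _ xe)// /normsq (bigD1 j)//= lerDl.
by apply: sumr_ge0 => l _; exact: sqr_ge0.
Qed.

Lemma normsq_continuous : continuous normsq.
Proof.
(* With no parameters at all ([np = 0]), [normsq] is one of the polynomial functions already known
   to be continuous. *)
have -> : normsq = (fun x => evalxp (sqnormx R n 0) x 0).
  by apply/funext => x; rewrite evalxp_sqnormx.
exact: evalxp_continuous.
Qed.

End NormSq.

(** * Walks around the cycle, and sequences contracting once per lap *)

(** Unique outgoing edges make the walk an orbit of a map [next], and unique incoming edges make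
    [next] injective, hence a permutation of the finite set of modes. Connectedness leaves it a
    single orbit. *)
Lemma cyclic_walk_visits {R : realType} {n : nat} (H : hybrid_data R n)
    (rho : nat -> mode H) i (q : mode H) :
  cyclic_system H ->
  (forall l, (i <= l)%N -> (rho l, rho l.+1) \in edges H) ->
  exists2 l, (l < #|mode H|)%N & rho (i + l)%N = q.
Proof.
move=> [out inc conn] rhoE.
have /choice[next nextP] : forall a, exists a', (a, a') \in edges H.
  by move=> a; have [[a1 a'] [[aE /= <-] _]] := out a; exists a'.
have next_uniq a a' : (a, a') \in edges H -> a' = next a.
  move=> aE; have [e [_ eU]] := out a.
  have := eU (a, next a) (conj (nextP a) erefl).
  by rewrite (eU (a, a') (conj aE erefl)) => -[].
have next_inj : injective next.
  move=> a a' aa'; have [e [_ eU]] := inc (next a).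
  have := eU (a, next a) (conj (nextP a) erefl).
  have := nextP a'; rewrite -aa' => a'E.
  by rewrite (eU (a', next a) (conj a'E erefl)) => -[].
(* Connectedness ignores orientation; an edge taken backwards is handled by the symmetry of
   [fconnect] for an injective map. *)
have fconn a a' : fconnect next a a'.
  apply: connect_sub (conn a a') => x y /orP[/next_uniq ->|/next_uniq ->].
    exact: fconnect1.
  by rewrite (fconnect_sym next_inj) fconnect1.
have rho_iter l : rho (i + l)%N = iter l next (rho i).
  elim: l => [|l IHl]; first by rewrite addn0.
  by rewrite addnS iterS -IHl -(next_uniq _ _ (rhoE _ (leq_addr _ _))).
exists (findex next (rho i) q); last by rewrite rho_iter iter_findex.
rewrite (leq_trans (findex_max (fconn _ _)))//.
by rewrite /order max_card.
Qed.

(** The terms at multiples of [M] are dominated by a geometric sequence, and monotonicity covers the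
    indices in between. *)
Lemma contracting_seq_small {R : realType} (u : nat -> R) (M : nat) (rho : R) :
  (forall i, 0 <= u i) -> (forall i, u i.+1 <= u i) ->
  0 <= rho < 1 -> (forall i, u (i + M)%N <= rho * u i) ->
  forall eps, 0 < eps -> exists N, forall i, (N <= i)%N -> u i <= eps.
Proof.
move=> u0 u_dec /andP[rho0 rho1] uM eps eps0.
have u_homo i l : (i <= l)%N -> u l <= u i.
  move=> /subnK <-; elim: (l - i)%N => // m IH.
  by rewrite addSn (le_trans (u_dec _)).
have um m : u (m * M)%N <= u 0 * rho ^+ m.
  elim: m => [|m IH]; first by rewrite mul0n expr0 mulr1.
  rewrite mulSn addnC (le_trans (uM _))// exprS mulrCA.
  exact: ler_wpM2l.
have /cvgrPdist_le/(_ _ eps0)[m _ um0] :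
    u 0 * rho ^+ m @[m --> \oo] --> (0 : R).
  by apply: cvg_geometric; rewrite ger0_norm.
exists (m * M)%N => i mi; apply: le_trans (u_homo _ _ mi) _.
apply: le_trans (um m) _; have := um0 m (leqnn m).
by rewrite sub0r normrN; exact: le_trans (ler_norm _).
Qed.

(** * A Lyapunov criterion for Zeno behavior near the origin *)

Section LyapunovZeno.
Context {R : realType} {n : nat} (H : hybrid_data R n)
  (V LV : mode H -> 'rV[R]_n -> R) (r : mode H -> R) (k alpha gamma : R).
(** [LV q] stands for the Lie derivative of [V q]. The lower bound in [V_reset] is a separate
    assumption because the reset point is not known beforehand to satisfy the norm bound that
    [V_pos] requires. *)
Hypotheses (Hsys : is_hybrid_system H) (Hcyc : cyclic_system H)
  (alpha0 : 0 < alpha) (gamma0 : 0 < gamma)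
  (r01 : forall q, 0 <= r q <= 1) (r_lt1 : exists q, r q < 1)
  (V_continuous : forall q, continuous (V q))
  (V_derive : forall q (c : R -> 'rV[R]_n) (t : R),
     is_derive t 1 c (vfield H q (c t)) ->
     is_derive t 1 (fun s => V q (c s)) (LV q (c t)))
  (V_pos : forall q x, dom H q x -> normsq x <= k -> alpha * normsq x <= V q x)
  (V_decr : forall q x, dom H q x -> normsq x <= k -> LV q x <= - gamma)
  (V_reset : forall e x, e \in edges H -> guard H e x -> normsq x <= k ->
     alpha * normsq (reset H e x) <= V e.2 (reset H e x) <= r e.1 * V e.1 x).

(* The norm bound is not redundant: [V] is controlled only where
   [normsq x <= k]. *)
Definition trapped q x :=
  [/\ dom H q x, normsq x < k & V q x < alpha * k].

Lemma trapped_ge0 q x : trapped q x -> 0 <= V q x.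
Proof.
move=> [dx xk _]; apply: le_trans (V_pos _ _ dx (ltW xk)).
by rewrite mulr_ge0 ?normsq_ge0// ltW.
Qed.

(** The norm bound after the jump is recovered from the energy: with [y] the reset point, [alpha *
    normsq y <= V y <= r * V x < alpha * k]. *)
Lemma trapped_reset e x : e \in edges H -> guard H e x -> trapped e.1 x ->
  trapped e.2 (reset H e x).
Proof.
move=> eE gx tx; have [_ xk Vk] := tx.
have /andP[Vy yV] := V_reset _ _ eE gx (ltW xk).
have Vyk : V e.2 (reset H e x) < alpha * k.
  apply: le_lt_trans (le_trans yV _) Vk.
  by rewrite ler_piMl ?(trapped_ge0 _ _ tx)//; case/andP: (r01 e.1).
split => //; first exact: (Hsys _ eE).2.
by rewrite -(ltr_pM2l alpha0) (le_lt_trans Vy).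
Qed.

Lemma trapped_flow q (c : R -> 'rV[R]_n) (a b : R) : a <= b ->
  {within `[a, b], continuous c} ->
  (forall t, a < t < b -> is_derive t 1 c (vfield H q (c t))) ->
  (forall t, a <= t <= b -> dom H q (c t)) ->
  trapped q (c a) ->
  trapped q (c b) /\ V q (c b) <= V q (c a) - gamma * (b - a).
Proof.
move=> ab cc dc domc [_ ak aV].
have within_comp (f : 'rV[R]_n -> R) : continuous f ->
    {within `[a, b], continuous (f \o c)}.
  by move=> cf x; apply: continuous_comp (cc x) (cf _).
have [] := @lyapunov_decay _ (normsq \o c) (V q \o c) (LV q \o c)
  a b k alpha gamma alpha0 (ltW gamma0) ab
  (within_comp _ normsq_continuous) (within_comp _ (V_continuous q)) _ _ _
  ak aV b.
- by move=> t /dc /V_derive.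
- by move=> t /domc; exact: V_pos.
- by move=> t /andP[at_ tb]; apply: V_decr; apply: domc; rewrite !ltW.
- by rewrite ab lexx.
move=> /= bk bV; split => //; split => //.
  by apply: domc; rewrite ab lexx.
apply: le_lt_trans bV _; apply: le_lt_trans aV.
by rewrite gerBl mulr_ge0 ?subr_ge0// ltW.
Qed.

Section Execution.
Context (q0 : mode H) (x0 : 'rV[R]_n)
  (J : set nat) (tau : nat -> \bar R) (rho : nat -> mode H)
  (c : nat -> R -> 'rV[R]_n).
Hypotheses (x0_trapped : trapped q0 x0)
  (chiP : is_execution q0 x0 (Trajectory J tau rho c)).

(** For [i] in [J] the time [tau i] is finite, so [fine] loses nothing there. *)
Let t_ i := fine (tau i).
Let S i := V (rho i) (c i (t_ i)).

(** An execution lies in the domain at interior times only. At [b] this is therefore a hypothesis,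
    to be supplied by the guard at a transition and by the flow at an interior time; at the left
    endpoint it is part of [trapped]. *)
Lemma interval_flow i (b : R) : J i -> trapped (rho i) (c i (t_ i)) ->
  (tau i <= b%:E <= tau i.+1)%E -> dom H (rho i) (c i b) ->
  trapped (rho i) (c i b) /\
  V (rho i) (c i b) <= S i - gamma * (b - t_ i).
Proof.
move: chiP => [_ [_ fin_tau _] _ flow _] Ji ti /andP[ib bi] db.
have tauE : tau i = (t_ i)%:E by rewrite fineK// fin_tau.
have [cc dc] := flow i Ji.
have ab : t_ i <= b by rewrite -lee_fin -tauE.
have int_t t : t_ i < t < b -> (tau i < t%:E < tau i.+1)%E.
  by rewrite tauE lte_fin => /andP[-> tb]; rewrite (lt_le_trans _ bi).
apply: trapped_flow => //.
- apply: continuous_subspaceW cc => t /=; rewrite in_itv/= tauE lee_fin.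
  by move=> /andP[-> tb]; rewrite (le_trans _ bi).
- by move=> t /int_t/dc[].
- move=> t /andP[]; rewrite le_eqVlt => /predU1P[<- _|at_]; first by case: ti.
  rewrite le_eqVlt => /predU1P[->//|tb].
  by have /dc[] : (tau i < t%:E < tau i.+1)%E by apply: int_t; rewrite at_.
Qed.

Lemma transition i : J i -> J i.+1 -> trapped (rho i) (c i (t_ i)) ->
  [/\ trapped (rho i) (c i (t_ i.+1)),
      V (rho i) (c i (t_ i.+1)) <= S i - gamma * (t_ i.+1 - t_ i),
      trapped (rho i.+1) (c i.+1 (t_ i.+1)) &
      S i.+1 <= r (rho i) * V (rho i) (c i (t_ i.+1))].
Proof.
move=> Ji Ji1 ti; have [_ [_ fin_tau le_tau] _ _ jump] := chiP.
have [eE gy yE] := jump i Ji Ji1.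
have [] := interval_flow i (t_ i.+1) Ji ti.
- by rewrite fineK ?fin_tau// lexx le_tau.
- exact: (Hsys _ eE).1.
move=> ti1 Vi1; split => //.
- by rewrite yE; exact: (@trapped_reset (rho i, rho i.+1)).
- rewrite /S yE; have [_ /ltW ik _] := ti1.
  by have /andP[] := V_reset _ _ eE gy ik.
Qed.

(** The quantity [gamma * time + V] never increases: during the flow [V] loses at least [gamma] per
    unit of time, and a jump cannot raise [V] since [r <= 1]. *)
Lemma trapped_energy i : J i ->
  trapped (rho i) (c i (t_ i)) /\ gamma * t_ i + S i <= V q0 x0.
Proof.
move: (chiP) => [[_ J_ge1 J_prev] [tau1 _ _] [rho1 c1] _ _].
(* Indices start at 1: index 0 is vacuous, and the base case is index 1. *)
elim: i => [/J_ge1//|[|i] IH] Ji1.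
  by rewrite /S /t_ tau1/= rho1 c1 mulr0 add0r.
have Ji := J_prev _ (ltn0Sn i) Ji1.
have [ti Si] := IH Ji.
have [ti1 Vi1 ti2 Si2] := transition _ Ji Ji1 ti.
split => //; apply: le_trans Si.
have : S i.+2 <= V (rho i.+1) (c i.+1 (t_ i.+2)).
  rewrite (le_trans Si2)// ler_piMl ?(trapped_ge0 _ _ ti1)//.
  by case/andP: (r01 (rho i.+1)).
by lra.
Qed.

Lemma no_unbounded_interval i : J i -> tau i.+1 = +oo%E -> False.
Proof.
move=> Ji tauy; have [ti _] := trapped_energy _ Ji.
have [_ [_ fin_tau _] _ flow _] := chiP.
(* Staying until [b] would consume one unit of time beyond the budget [S i / gamma], leaving [V] at
   most [- gamma], against its nonnegativity. *)
pose b := t_ i + S i / gamma + 1.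
have Si0 : 0 <= S i / gamma by rewrite divr_ge0 ?(trapped_ge0 _ _ ti)// ltW.
have tib : t_ i < b by rewrite /b; lra.
have tauE : tau i = (t_ i)%:E by rewrite fineK// fin_tau.
have [|| tb Vb] := interval_flow i b Ji ti.
- by rewrite tauy leey tauE lee_fin ltW.
- by have [_ /(_ b)[|//]] := flow i Ji; rewrite tauE tauy lte_fin tib ltry.
have := le_trans (trapped_ge0 _ _ tb) Vb.
have -> : b - t_ i = S i / gamma + 1 by rewrite /b; ring.
by rewrite mulrDr mulrCA divff ?gt_eqF// => ?; move: gamma0; lra.
Qed.

Lemma complete_infinite : complete (Trajectory J tau rho c) -> J = all_indices.
Proof. by move=> [//|[i Ji /(no_unbounded_interval _ Ji)]]. Qed.

(** By the energy bound, the nondecreasing switching times are bounded by [V q0 x0 / gamma], hence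
    converge. *)
Lemma infinite_zeno : J = all_indices -> is_zeno (Trajectory J tau rho c).
Proof.
move=> JE; split => //=; have [_ [_ fin_tau le_tau] _ _ _] := chiP.
have J1 i : J i.+1 by rewrite JE.
have tauE i : tau i.+1 = (t_ i.+1)%:E by rewrite fineK// fin_tau.
(* The shift skips [tau 0], on which an execution puts no constraint. *)
have cvg_t : cvgn (fun i => t_ i.+1).
  apply: nondecreasing_is_cvgn.
    by apply/nondecreasing_seqP => i; rewrite -lee_fin -!tauE le_tau.
  exists (V q0 x0 / gamma) => _ [i _ <-].
  have [ti Si] := trapped_energy _ (J1 i).
  rewrite ler_pdivlMr// mulrC.
  by have := trapped_ge0 _ _ ti; rewrite -/(S _); lra.
exists (limn (fun i => t_ i.+1)); rewrite -cvg_shiftS/=.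
by under eq_fun do rewrite tauE; apply/cvg_EFin => //; near=> i.
Unshelve. all: by end_near. Qed.

(** Any [#|mode H|] consecutive transitions include one out of a mode [q] with [r q < 1], so the
    entry energies [S] contract once per lap. They dominate the exit energies, which in turn
    dominate [alpha * normsq] at the exit points. *)
Lemma infinite_endpoints_small : J = all_indices ->
  forall eps, 0 < eps -> exists N, forall i, (N < i)%N ->
    normsq (c i (t_ i.+1)) <= eps.
Proof.
move=> JE eps eps0; have [_ _ _ _ jump] := chiP.
have J1 i : J i.+1 by rewrite JE.
have T i : trapped (rho i.+1) (c i.+1 (t_ i.+1)).
  by have [] := trapped_energy _ (J1 i).
have S0 i : 0 <= S i.+1 by exact: trapped_ge0 (T i).
have t_le i : t_ i.+1 <= t_ i.+2.
  have [_ [_ fin_tau le_tau] _ _ _] := chiP.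
  by rewrite fine_le ?fin_tau ?le_tau.
have VS i : V (rho i.+1) (c i.+1 (t_ i.+2)) <= S i.+1.
  have [_ Vi _ _] := transition _ (J1 i) (J1 i.+1) (T i).
  by rewrite (le_trans Vi)// gerBl mulr_ge0 ?subr_ge0// ltW.
have Sr i : S i.+2 <= r (rho i.+1) * S i.+1.
  have [_ _ _ Si] := transition _ (J1 i) (J1 i.+1) (T i).
  by rewrite (le_trans Si)// ler_wpM2l//; case/andP: (r01 (rho i.+1)).
have Sdec i : S i.+2 <= S i.+1.
  by rewrite (le_trans (Sr i))// ler_piMl//; case/andP: (r01 (rho i.+1)).
have Shomo i l : S (i + l).+1 <= S i.+1.
  by elim: l => [|l IH]; rewrite ?addn0// addnS (le_trans (Sdec _)).
have [q rq1] := r_lt1.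
have [|||N SN] := @contracting_seq_small _ (fun i => S i.+1) #|mode H| (r q)
    S0 Sdec _ _ (alpha * eps).
- by case/andP: (r01 q) => -> _.
- move=> i; have [l lt_l rhoq] :
      exists2 l, (l < #|mode H|)%N & rho (i.+1 + l)%N = q.
    apply: cyclic_walk_visits => // -[//|l] _.
    by have [] := jump _ (J1 l) (J1 l.+1).
  (* The factor [r q] is gained on entering interval [(i + l).+2]; monotonicity of [S] handles the
     transitions before and after it within the lap. *)
  apply: le_trans (_ : S (i + l).+2 <= _).
    by rewrite -(subnKC lt_l) addnA addnS; exact: Shomo.
  rewrite addSn in rhoq; apply: le_trans (Sr _) _; rewrite rhoq.
  by apply: ler_wpM2l; [case/andP: (r01 q)|exact: Shomo].
- exact: mulr_gt0.
exists N => -[//|i] Ni; rewrite -(ler_pM2l alpha0).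
apply: le_trans (SN i Ni).
apply: le_trans (VS i).
have [[di ki _] _ _ _] := transition _ (J1 i) (J1 i.+1) (T i).
exact: V_pos _ _ di (ltW ki).
Qed.

End Execution.

Theorem lyapunov_zeno q0 x0 (chi : trajectory R n (mode H)) :
  trapped q0 x0 -> is_execution q0 x0 chi -> complete chi ->
  is_zeno chi /\
  forall eps, 0 < eps -> exists N, forall i, (N < i)%N ->
    normsq (curve chi i (fine (time chi i.+1))) <= eps.
Proof.
case: chi => J tau rho c x0P chiP /(complete_infinite _ _ _ _ _ _ x0P chiP) JE.
split; first exact: infinite_zeno _ _ _ _ _ _ x0P chiP JE.
exact: infinite_endpoints_small _ _ _ _ _ _ x0P chiP JE.
Qed.

End LyapunovZeno.

(** * From the sum-of-squares certificates to the Lyapunov criterion *)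

Theorem theorem9 (R : realType) (n np : nat) (Q : finType)
    (H : poly_family R n np Q)
    (K1 : nat) (pi_ : 'I_K1 -> mpoly np R)
    (z : Q -> 'rV[R]_n)
    (Kw : Q -> nat) (w : forall q, 'I_(Kw q) -> mpoly n R)
    (Hsys : forall p, semialgebraic pi_ p -> is_hybrid_system (system_at H p))
    (Hcyc : forall p, semialgebraic pi_ p -> cyclic_system (system_at H p))
    (Hz : forall p, semialgebraic pi_ p -> zeno_equilibrium (H := system_at H p) z)
    (Hw : forall q, nbhs (z q) (semialgebraic_gt (w q)))
    (a c i_ : forall q, 'I_(Kw q) -> mpoly (n + np) R)
    (b d j_ : forall q, 'I_(Kdom H q) -> mpoly (n + np) R)
    (eta beta zeta : Q -> 'I_K1 -> mpoly (n + np) R)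
    (m : forall e : Q * Q, 'I_(Nguard H e.1) -> mpoly (n + np) R)
    (V : Q -> mpoly (n + np) R) (m0 : Q * Q -> mpoly (n + np) R)
    (alpha gamma : R) (r : Q -> R)
    (Hi : forall q k, [/\ sos (a q k), sos (c q k) & sos (i_ q k)])
    (Hii : forall q k, [/\ sos (b q k), sos (d q k) & sos (j_ q k)])
    (Hiii : forall q k, [/\ sos (eta q k), sos (beta q k) & sos (zeta q k)])
    (Hiv : forall e, e \in fedges H -> forall l, sos (m e l))
    (Halpha : 0 < alpha) (Hgamma : 0 < gamma)
    (Hr : forall q, 0 < r q <= 1) (Hr1 : exists q, r q < 1)
    (Hpos : forall q,
      sos (V q - alpha *: sqnormx R n np
           - \sum_(k < Kw q) a q k * of_polyx np (w q k)
           - \sum_(k < Kdom H q) b q k * gdom H q k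
           - \sum_(k < K1) eta q k * of_polyp n (pi_ k)))
    (Hzero : forall q p, semialgebraic pi_ p -> evalxp (V q) (z q) p = 0)
    (Hdecr : forall q,
      sos (- lie_derivx (V q) (fpoly H q) - mpolyC (n + np) gamma
           - \sum_(k < Kw q) c q k * of_polyx np (w q k)
           - \sum_(k < Kdom H q) d q k * gdom H q k
           - \sum_(k < K1) beta q k * of_polyp n (pi_ k)))
    (Hjump : forall e, e \in fedges H ->
      let q := e.1 in
      let q' := e.2 in
      sos (r q *: V q - compx (V q') (phipoly H e)
           - m0 e * hguard0 H e
           - \sum_(l < Nguard H q) m e l * hguard H e l
           - \sum_(k < Kw q) i_ q k * of_polyx np (w q k)
           - \sum_(k < Kdom H q) j_ q k * gdom H q k
           - \sum_(k < K1) zeta q k * of_polyp n (pi_ k))) :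
  forall p, semialgebraic pi_ p ->
    zeno_equilibrium (H := system_at H p) z /\
    zeno_stable (H := system_at H p) z.
Proof.
move=> p Pp; split; first exact: Hz.
have [zD zG _] := Hz p Pp.
pose D := dom (system_at H p).
pose W q := semialgebraic_gt (w q).
have pi0 l x : 0 <= evalxp (of_polyp n (pi_ l)) x p.
  by rewrite evalxp_of_polyp Pp.
have w0 q x : W q x -> forall l, 0 <= evalxp (of_polyx np (w q l)) x p.
  by move=> Wx l; rewrite evalxp_of_polyx ltW// Wx.
(* Evaluated at [(x, p)], every subtracted sum pairs sum-of-squares multipliers with quantities that
   are nonnegative on [D q], [W q] or the parameter set, so dropping these sums leaves the desired
   inequality. *)
have V_pos q x : D q x -> W q x -> alpha * normsq x <= evalxp (V q) x p.
  move=> Dx Wx; have := sos_ge0 _ x p (Hpos q).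
  rewrite /evalxp !mevalB mevalZ -!/(evalxp _ x p) evalxp_sqnormx -/(normsq x).
  have := evalxp_sos_comb_ge0 _ _ _ x p
    (fun l => let: And3 s _ _ := Hi q l in s) (w0 q x Wx).
  have := evalxp_sos_comb_ge0 _ _ _ x p
    (fun l => let: And3 s _ _ := Hii q l in s) Dx.
  have := evalxp_sos_comb_ge0 _ _ _ x p
    (fun l => let: And3 s _ _ := Hiii q l in s) (pi0^~ x).
  lra.
have V_decr q x : D q x -> W q x ->
    evalxp (lie_derivx (V q) (fpoly H q)) x p <= - gamma.
  move=> Dx Wx; have := sos_ge0 _ x p (Hdecr q).
  rewrite /evalxp !mevalB mevalN mevalC -!/(evalxp _ x p).
  have := evalxp_sos_comb_ge0 _ _ _ x p
    (fun l => let: And3 _ s _ := Hi q l in s) (w0 q x Wx).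
  have := evalxp_sos_comb_ge0 _ _ _ x p
    (fun l => let: And3 _ s _ := Hii q l in s) Dx.
  have := evalxp_sos_comb_ge0 _ _ _ x p
    (fun l => let: And3 _ s _ := Hiii q l in s) (pi0^~ x).
  lra.
have V_jump e x : e \in fedges H -> guard (system_at H p) e x -> W e.1 x ->
    evalxp (V e.2) (reset (system_at H p) e x) p <= r e.1 * evalxp (V e.1) x p.
  move=> eE [Dx h0 hx] Wx; have := sos_ge0 _ x p (Hjump e eE).
  (* The multiplier [m0 e] has no sign, but its term vanishes because [hguard0 H e] is zero on the
     guard. *)
  rewrite /evalxp !mevalB mevalZ mevalM -!/(evalxp _ x p) h0 mulr0 evalxp_compx.
  have := evalxp_sos_comb_ge0 _ _ _ x p (Hiv e eE) hx.
  have := evalxp_sos_comb_ge0 _ _ _ x p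
    (fun l => let: And3 _ _ s := Hi e.1 l in s) (w0 e.1 x Wx).
  have := evalxp_sos_comb_ge0 _ _ _ x p
    (fun l => let: And3 _ _ s := Hii e.1 l in s) Dx.
  have := evalxp_sos_comb_ge0 _ _ _ x p
    (fun l => let: And3 _ _ s := Hiii e.1 l in s) (pi0^~ x).
  rewrite /=; lra.
have Wz q : W q (z q) by exact: nbhs_singleton (Hw q).
have z0 q : z q = 0.
  apply: normsq_le0; have := V_pos _ _ (zD q) (Wz q).
  by rewrite Hzero// pmulr_rle0.
(* All [z q] being 0, and modes and edges being finite in number, one radius serves them all.
   Positivity of the [w] after a reset is also required, so that [V_pos] applies at the reset point
   and gives the lower bound in [V_reset]. *)
have [|k k0 kW] := @nbhs0_normsq R n [set x | (forall q, W q x) /\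
    (forall e, e \in fedges H -> W e.2 (reset (system_at H p) e x))].
  have F0 : Filter (nbhs (0 : 'rV[R]_n)) by exact: nbhs_filter.
  have W0 : \forall x \near (0 : 'rV[R]_n), forall q, W q x.
    apply: (@filter_forall _ _ W _ F0) => q; rewrite -(z0 q); exact: Hw.
  suff W1 : \forall x \near (0 : 'rV[R]_n), forall e, e \in fedges H ->
      W e.2 (reset (system_at H p) e x) by exact: filterI W0 W1.
  apply: (@filter_forall _ (Q * Q)%type (fun e x => e \in fedges H ->
    W e.2 (reset (system_at H p) e x)) _ F0) => e.
  have [eE|_] := boolP (e \in fedges H); last exact: nearW.
  suff : \forall x \near (0 : 'rV[R]_n), W e.2 (reset (system_at H p) e x).
    by apply: filterS => x.
  apply: (@filter_forall _ 'I_(Kw e.2) (fun l x => 0 <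
    meval (fun i => reset (system_at H p) e x 0 i) (w e.2 l)) _ F0) => l.
  (* Positivity of [w] after the reset is that of a polynomial in [x]. *)
  pose u := compx (of_polyx np (w e.2 l)) (phipoly H e).
  have uE x : evalxp u x p
      = meval (fun i => reset (system_at H p) e x 0 i) (w e.2 l).
    by rewrite evalxp_compx evalxp_of_polyx.
  suff : \forall x \near (0 : 'rV[R]_n), 0 < evalxp u x p.
    by apply: filterS => x; rewrite uE.
  apply: cvgr_gt (evalxp_continuous u p 0) _ _.
  (* The reset sends [z e.1 = 0] to [z e.2], which lies in [W e.2]. *)
  rewrite uE -(z0 e.1) (zG e eE).2; exact: Wz.
(* The trap is a relative neighborhood of 0: its two strict inequalities are open conditions that
   hold at 0, where both [normsq] and [V] vanish. *)
exists (trapped (system_at H p) (fun q x => evalxp (V q) x p) k alpha).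
split.
  move=> q; split; first by move=> x [].
  rewrite z0.
  have Nk : \forall x \near (0 : 'rV[R]_n), normsq x < k.
    apply: cvgr_lt (normsq_continuous 0) _ _.
    by rewrite /normsq big1// => l _; rewrite mxE expr0n.
  have Vk : \forall x \near (0 : 'rV[R]_n), evalxp (V q) x p < alpha * k.
    apply: cvgr_lt (evalxp_continuous (V q) p 0) _ _.
    by rewrite -(z0 q) Hzero// mulr_gt0.
  rewrite /within/=; near=> x => Dx.
  by split => //; [near: x; exact: Nk|near: x; exact: Vk].
move=> q0 x0 x0Z chi chiP chi_complete.
have r01 q : 0 <= r q <= 1 by have /andP[/ltW-> ->] := Hr q.
have V_der q (c1 : R -> 'rV[R]_n) (t : R) :
    is_derive t 1 c1 (vfield (system_at H p) q (c1 t)) ->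
    is_derive t 1 (fun s => evalxp (V q) (c1 s) p)
      (evalxp (lie_derivx (V q) (fpoly H q)) (c1 t) p).
  move=> /(is_derive_evalxp (V q) p)/is_derive_eq; apply.
  rewrite [RHS]/evalxp raddf_sum; apply: eq_bigr => l _ /=.
  by rewrite mevalM mxE.
have V_pos_k q x : D q x -> normsq x <= k ->
    alpha * normsq x <= evalxp (V q) x p.
  by move=> Dx /kW[Wx _]; exact: V_pos.
have V_decr_k q x : D q x -> normsq x <= k ->
    evalxp (lie_derivx (V q) (fpoly H q)) x p <= - gamma.
  by move=> Dx /kW[Wx _]; exact: V_decr.
have V_reset e x : e \in fedges H -> guard (system_at H p) e x ->
    normsq x <= k ->
    alpha * normsq (reset (system_at H p) e x)
      <= evalxp (V e.2) (reset (system_at H p) e x) p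
      <= r e.1 * evalxp (V e.1) x p.
  move=> eE gx /kW[Wx Wy]; rewrite V_jump// andbT V_pos//; last exact: Wy.
  exact: (Hsys p Pp e eE).2.
have [zeno small] := lyapunov_zeno (system_at H p) _ _ r k alpha gamma
  (Hsys p Pp) (Hcyc p Pp) Halpha Hgamma r01 Hr1
  (fun q => evalxp_continuous (V q) p) V_der V_pos_k V_decr_k V_reset
  q0 x0 chi x0Z chiP chi_complete.
(* Since [normsq] is the square of the Euclidean norm, the tolerance passed on is [eps ^+ 2]. *)
split => // eps eps0; have [N smallN] := small _ (exprn_gt0 2 eps0).
exists N => i Ni; rewrite z0 subr0 -[leRHS]ger0_norm ?(ltW eps0)// -sqrtr_sqr.
exact: (ler_wsqrtr (smallN i Ni)).
Unshelve. all: by end_near. Qed.
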